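(* Let $\lambda$ be a positive integer and let $B$ be a binary frequency square of order $2\lambda$. Then $B$ is a bachelor if and only if $\lambda$ is odd and $B$ is isomorphic to $A_{2\lambda}$.
   Context: Let $N(n)=\{1,\dots,n\}$ and let $n$ be even. A (binary) frequency square of order $n$ is an $n\times n$ array indexed by $N(n)\times N(n)$ with entries in $\{0,1\}$ such that every row and every column contains exactly $n/2$ zeros and $n/2$ ones. Two frequency squares $F,G$ of order $n$ are orthogonal if for each $(a,b)\in\{0,1\}^2$ the number of cells $(r,c)$ with $(F[r,c],G[r,c])=(a,b)$ equals $n^2/4$. A frequency square is a bachelor if no frequency square of the same order is orthogonal to it. $A_{2\lambda}$ denotes the frequency square of order $2\lambda$ with $A_{2\lambda}[r,c]=0$ if either both $r,c\le\lambda$ or both $r,c>\lambda$, and $A_{2\lambda}[r,c]=1$ otherwise (block form $\begin{bmatrix}\mathbf 0&\mathbf 1\\ \mathbf 1&\mathbf 0\end{bmatrix}$ with $\lambda\times\lambda$ constant blocks). Two frequency squares are isomorphic if one can be obtained from the other by permuting rows, permuting columns, transposing, and interchanging the symbols $0$ and $1$. *)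

(* Defs.v *)
From mathcomp Require Import all_boot all_order all_fingroup all_algebra.

Set Implicit Arguments.
Unset Strict Implicit.
Unset Printing Implicit Defensive.

(* The symbols 0 and 1 are encoded as [false] and [true]; rows and columns are
   numbered from 0, so "r <= k" in 1-based numbering becomes "r < k". *)

Definition frequency_square (n : nat) (F : 'M[bool]_n) : Prop :=
  [/\ ~~ odd n,
      forall (r : 'I_n) (a : bool), #|[set c : 'I_n | F r c == a]| = n %/ 2
    & forall (c : 'I_n) (a : bool), #|[set r : 'I_n | F r c == a]| = n %/ 2].

Definition orthogonal_squares (n : nat) (F G : 'M[bool]_n) : Prop :=
  forall a b : bool,
    #|[set rc : 'I_n * 'I_n | (F rc.1 rc.2, G rc.1 rc.2) == (a, b)]|
      = n ^ 2 %/ 4.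

Definition bachelor (n : nat) (F : 'M[bool]_n) : Prop :=
  frequency_square F /\
  ~ exists G : 'M[bool]_n, frequency_square G /\ orthogonal_squares F G.

Definition A_square (lambda : nat) : 'M[bool]_(2 * lambda) :=
  \matrix_(r, c) if (r < lambda) && (c < lambda)
                    || (lambda <= r) && (lambda <= c) then false else true.

(* [isomorphic F G]: G is obtained from F by finitely many moves.  The moves
   are invertible, so the relation is symmetric. *)
Inductive isomorphic (n : nat) (F : 'M[bool]_n) : 'M[bool]_n -> Prop :=
| iso_refl : isomorphic F F
| iso_rows (G : 'M[bool]_n) (s : 'S_n) :
    isomorphic F G -> isomorphic F (row_perm s G)
| iso_cols (G : 'M[bool]_n) (s : 'S_n) :
    isomorphic F G -> isomorphic F (col_perm s G)
| iso_transpose (G : 'M[bool]_n) : isomorphic F G -> isomorphic F (trmx G)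
| iso_symbols (G : 'M[bool]_n) :
    isomorphic F G -> isomorphic F (map_mx negb G).

(* Main.v *)
(** Call a square F rectangle-even if every 2x2 subarray contains an even
    number of ones.  Such an F has the form f(r) + g(c) mod 2 with f and g
    balanced, so it is a rearrangement of A; conversely evenness is invariant
    under isomorphism.  For such an F, a mate G would have 2 S = lambda^2, where
    S is the number of ones of G in the block f = g = 0; when lambda is even,
    G = h(r) + k(c) is a mate as soon as h halves both classes of f and k both
    classes of g.

    If some 2x2 subarray of F is odd, pair up the rows and the columns so that
    it is one of the lambda^2 blocks.  Filling every block with [0 1; 1 0] or
    [1 0; 0 1] arbitrarily yields a frequency square, which is orthogonal to F
    iff a signed sum of the alternating block sums d of F vanishes.  Since
    |d| <= 2, greedy signs on the remaining blocks give a sum in [-2, 2]; it is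
    odd, hence 1 or -1, and the odd block, with |d| = 1, cancels it. *)

Require Import Defs.
From mathcomp Require Import all_boot all_order all_fingroup all_algebra.
From mathcomp Require Import zify ring.

Set Implicit Arguments.
Unset Strict Implicit.
Unset Printing Implicit Defensive.

Import Order.TTheory GRing.Theory Num.Theory.
Local Open Scope ring_scope.

(** * Balance and orthogonality as vanishing sign sums *)

Lemma sum_pair (I J : finType) (F : I * J -> int) :
  \sum_z F z = \sum_i \sum_j F (i, j).
Proof. by rewrite pair_bigA; apply: eq_bigr => -[]. Qed.

Lemma card_sum_int (T : finType) (P : pred T) :
  #|[set x | P x]|%:Z = \sum_x (P x : nat)%:Z.
Proof.
rewrite -sum1_card (big_morph Posz PoszD (erefl _)) big_mkcond /=.
by apply: eq_bigr => x _; rewrite inE; case: (P x).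
Qed.

Lemma sum_one_int (T : finType) : \sum_(x : T) (1 : int) = #|T|%:Z.
Proof. by rewrite sumr_const -[in RHS](mulr1n #|T|%:Z) -natz. Qed.

(** Twice the indicator of [u x = a] is [1 + (-1)^a (-1)^(u x)]. *)
Lemma card_eq_sign_sum (T : finType) (u : T -> bool) (a : bool) :
  #|[set x | u x == a]|%:Z * 2
    = #|T|%:Z + (-1) ^+ a * \sum_x (-1) ^+ (u x).
Proof.
rewrite card_sum_int mulr_suml mulr_sumr -sum_one_int -big_split /=.
by apply: eq_bigr => x _; case: (u x); case: a.
Qed.

(** The product of the two doubled indicators expands into four characters, one for each of 1, [u],
    [v] and [u (+) v]. *)
Lemma card_pair_eq_sign_sum (T : finType) (u v : T -> bool) (a b : bool) :
  #|[set x | (u x, v x) == (a, b)]|%:Z * 4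
    = #|T|%:Z + (-1) ^+ a * \sum_x (-1) ^+ (u x)
      + (-1) ^+ b * \sum_x (-1) ^+ (v x)
      + (-1) ^+ (a (+) b) * \sum_x (-1) ^+ (u x (+) v x).
Proof.
rewrite card_sum_int mulr_suml !mulr_sumr -sum_one_int -!big_split /=.
by apply: eq_bigr => x _; case: (u x); case: (v x); case: a; case: b.
Qed.

Lemma balanced_sign_sum (T : finType) (u : T -> bool) :
  ~~ odd #|T| ->
  (\sum_x (-1) ^+ (u x) = 0 :> int) <->
  (forall a : bool, #|[set x | u x == a]| = (#|T| %/ 2)%N).
Proof.
move=> evT; split=> [s0 a | H].
  by have := card_eq_sign_sum u a; rewrite s0 mulr0 => ?; lia.
by have := card_eq_sign_sum u false; rewrite H expr0 mul1r => ?; lia.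
Qed.

Lemma frequency_squareP (n : nat) (F : 'M[bool]_n) :
  frequency_square F <->
  [/\ ~~ odd n, forall r, \sum_c (-1) ^+ (F r c) = 0 :> int
    & forall c, \sum_r (-1) ^+ (F r c) = 0 :> int].
Proof.
have cn := card_ord n.
split=> -[evn Hr Hc]; split=> //.
- by move=> r; apply/balanced_sign_sum; rewrite ?cn.
- by move=> c; apply/(balanced_sign_sum (fun r => F r c)); rewrite ?cn.
- by move=> r a; have /balanced_sign_sum -> := Hr r; rewrite ?cn.
by move=> c a; have /(balanced_sign_sum (fun r => F r c)) -> := Hc c; rewrite ?cn.
Qed.

Lemma frequency_square_sum (n : nat) (F : 'M[bool]_n) :
  frequency_square F -> \sum_r \sum_c (-1) ^+ (F r c) = 0 :> int.
Proof. by move=> /frequency_squareP[_ Hr _]; rewrite big1. Qed.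

(** Both single sign sums vanish by balance, so all four counts are governed by the one mixed
    sum. *)
Lemma orthogonal_squaresP (n : nat) (F G : 'M[bool]_n) :
  frequency_square F -> frequency_square G ->
  orthogonal_squares F G <->
  \sum_r \sum_c (-1) ^+ (F r c (+) G r c) = 0 :> int.
Proof.
move=> fsF fsG; have evn : ~~ odd n by case: fsF.
have := frequency_square_sum fsF; have := frequency_square_sum fsG.
rewrite !pair_bigA /= => sG sF.
have K := card_pair_eq_sign_sum (fun rc : 'I_n * 'I_n => F rc.1 rc.2)
            (fun rc => G rc.1 rc.2).
rewrite /= sF sG card_prod card_ord in K.
(* Since [n] is even, the truncated division by 4 is exact. *)
have n4 : (n ^ 2 %/ 4 * 4 = n * n)%N.
  have -> : n = (n./2 * 2)%N by lia.
  by rewrite expnMn mulnK //; lia.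
split=> [H | s0 a b].
  have := K false false; rewrite (H false false) !expr0 !mul1r.
  by set S := (X in _ + X) => ?; suff : S = 0 by []; lia.
by have := K a b; rewrite s0 !mulr0 !addr0 /= => ?; lia.
Qed.

(** * Rectangle-even squares and their normal form *)

Definition rect_even (n : nat) (F : 'M[bool]_n) : Prop :=
  forall r r' c c', F r c (+) F r c' = F r' c (+) F r' c'.

(** Evenness is pulled back through one move at a time; a row or column permutation is undone by
    evaluating at the preimages of the indices. *)
Lemma isomorphic_rect_even (n : nat) (F G : 'M[bool]_n) :
  isomorphic F G -> rect_even G -> rect_even F.
Proof.
elim=> // {}G => [s _ IH|s _ IH|_ IH|_ IH] ev; apply: IH => r r' c c'.
- by have := ev ((s^-1)%g r) ((s^-1)%g r') c c'; rewrite !mxE !permKV.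
- by have := ev r r' ((s^-1)%g c) ((s^-1)%g c'); rewrite !mxE !permKV.
- have := ev c c' r r'; rewrite !mxE.
  by case: (G r c); case: (G r c'); case: (G r' c); case: (G r' c').
have := ev r r' c c'; rewrite !mxE.
by case: (G r c); case: (G r c'); case: (G r' c); case: (G r' c').
Qed.

Lemma A_squareE (lambda : nat) (r c : 'I_(2 * lambda)) :
  A_square lambda r c = (lambda <= r)%N (+) (lambda <= c)%N.
Proof. by rewrite mxE; case: (leqP lambda r); case: (leqP lambda c). Qed.

Lemma rect_even_A_square (lambda : nat) : rect_even (A_square lambda).
Proof.
move=> r r' c c'; rewrite !A_squareE.
by do 4 case: (leqP lambda _) => _.
Qed.

(** Rectangles through the corner [(0, 0)] determine [F] from its first row and first column, whose
    balance gives that of [g] and [f]. *)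
Lemma rect_even_split (n : nat) (F : 'M[bool]_n) :
  (0 < n)%N -> frequency_square F -> rect_even F ->
  exists f g : 'I_n -> bool,
    [/\ forall r c, F r c = f r (+) g c,
        \sum_r (-1) ^+ (f r) = 0 :> int & \sum_c (-1) ^+ (g c) = 0 :> int].
Proof.
case: n F => // n F _ /frequency_squareP[_ Hr Hc] ev.
exists (fun r => F r ord0 (+) F ord0 ord0), (fun c => F ord0 c); split=> //.
  move=> r c; have := ev r ord0 c ord0.
  by case: (F r c); case: (F r ord0); case: (F ord0 c); case: (F ord0 ord0).
under eq_bigr do rewrite signr_addb.
by rewrite -mulr_suml Hc mul0r.
Qed.

(** Equal sign sums force equal numbers of each symbol, so the two value tuples are rearrangements
    of each other. *)
Lemma sign_sum_perm (n : nat) (f h : 'I_n -> bool) :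
  \sum_i (-1) ^+ (f i) = \sum_i (-1) ^+ (h i) :> int ->
  exists s : 'S_n, forall i, h i = f (s i).
Proof.
move=> eqs.
have /tuple_permP[s Hs] : perm_eq [tuple h i | i < n] [tuple f i | i < n].
  apply/allP => a _.
  have cnt (u : 'I_n -> bool) :
      count_mem a [tuple u i | i < n] = #|[set i | u i == a]|.
    rewrite /= count_map cardsE cardE size_filter enumT.
    by apply: eq_count => i.
  have := card_eq_sign_sum f a; rewrite eqs -card_eq_sign_sum => E.
  by apply/eqP/(etrans (cnt h))/(etrans _ (esym (cnt f))); lia.
exists s => i.
have := congr1 (fun t : n.-tuple bool => tnth t i) (val_inj Hs).
by rewrite !tnth_mktuple.
Qed.

(** The maps [f], [g] and [i |-> (lambda <= i)] are all balanced, so one row and one column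
    permutation turn [f (+) g] into [A_square lambda]. *)
Lemma rect_even_isomorphic_A (lambda : nat) (F : 'M[bool]_(2 * lambda)) :
  (0 < lambda)%N -> frequency_square F -> rect_even F ->
  isomorphic F (A_square lambda).
Proof.
move=> lam0 fsF evF.
have [|f [g [FE sf sg]]] := rect_even_split _ fsF evF; first by lia.
have sh : \sum_(i < 2 * lambda) (-1) ^+ (lambda <= i)%N = 0 :> int.
  rewrite -(big_mkord xpredT (fun i => (-1) ^+ (lambda <= i)%N)).
  rewrite (big_cat_nat _ (n := lambda)) //=; last by lia.
  rewrite (eq_big_nat _ _ (F2 := fun=> 1)); last first.
    by move=> i Hi; rewrite leqNgt (andP Hi).2.
  rewrite [X in _ + X](eq_big_nat _ _ (F2 := fun=> -1)); last first.
    by move=> i /andP[-> _].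
  by rewrite !big_const_nat !iter_addr_0; lia.
have [s Hs] := sign_sum_perm (etrans sf (esym sh)).
have [t Ht] := sign_sum_perm (etrans sg (esym sh)).
have -> : A_square lambda = col_perm t (row_perm s F).
  by apply/matrixP=> r c; rewrite A_squareE !mxE FE Hs Ht.
by apply: iso_cols; apply: iso_rows; apply: iso_refl.
Qed.

(** * No mate for rectangle-even squares when [lambda] is odd *)

Lemma rect_even_odd_no_mate (lambda : nat) (F G : 'M[bool]_(2 * lambda)) :
  odd lambda -> rect_even F -> frequency_square F -> frequency_square G ->
  ~ orthogonal_squares F G.
Proof.
move=> odl evF fsF fsG /(orthogonal_squaresP fsF fsG) s0.
have [|f [g [FE sf sg]]] := rect_even_split _ fsF evF; first by lia.
have /frequency_squareP[_ Hr Hc] := fsG.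
have zeros (u : 'I_(2 * lambda) -> bool) : \sum_i (-1) ^+ u i = 0 :> int ->
    \sum_i (~~ u i : nat)%:Z = lambda.
  move=> su; set S := LHS; suff: S * 2 = (2 * lambda)%N by lia.
  transitivity (#|'I_(2 * lambda)|%:Z + \sum_i (-1) ^+ u i); last first.
    by rewrite su card_ord addr0.
  rewrite -sum_one_int -big_split mulr_suml.
  by apply: eq_bigr => i _; case: (u i).
pose a r c := (~~ f r && ~~ g c : nat)%:Z.
have sa : \sum_r \sum_c a r c = lambda%:Z * lambda%:Z.
  rewrite -{1}(zeros f sf) -(zeros g sg) mulr_suml.
  apply: eq_bigr => r _; rewrite mulr_sumr; apply: eq_bigr => c _.
  by rewrite /a; case: (f r); case: (g c).
(* Here [4 a = (1 + (-1)^f) (1 + (-1)^g)]. After multiplying by [(-1)^G], three of the four sums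
   vanish by balance of [G] and the fourth by orthogonality. *)
have quad : \sum_r \sum_c a r c * (-1) ^+ G r c * 4 = 0.
  transitivity (\sum_r \sum_c ((-1) ^+ G r c + (-1) ^+ g c * (-1) ^+ G r c
     + ((-1) ^+ f r * (-1) ^+ G r c + (-1) ^+ (F r c (+) G r c))) : int).
    apply: eq_bigr => r _; apply: eq_bigr => c _; rewrite /a FE.
    by case: (f r); case: (g c); case: (G r c).
  under eq_bigr do rewrite !big_split /=.
  rewrite !big_split /= s0 (frequency_square_sum fsG).
  rewrite [X in 0 + X + _]exchange_big !big1 //= => [r _|c _].
    by rewrite -mulr_sumr Hr mulr0.
  by rewrite -mulr_sumr Hc mulr0.
(* Substitute [(-1)^G = 1 - 2 G]; with [quad] this makes [lambda^2] even. *)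
have quad2 : \sum_r \sum_c a r c * (-1) ^+ G r c
    = lambda%:Z * lambda%:Z - 2 * \sum_r \sum_c a r c * (G r c : nat)%:Z.
  rewrite -sa mulr_sumr -sumrB; apply: eq_bigr => r _.
  rewrite mulr_sumr -sumrB; apply: eq_bigr => c _.
  by case: (G r c) => /=; ring.
move: quad; under eq_bigr do rewrite -mulr_suml.
rewrite -mulr_suml quad2.
have : odd (lambda * lambda)%N by rewrite oddM odl.
by move=> ? ?; lia.
Qed.

(** * Pairing the indices *)

Lemma block_bijection (lambda : nat) :
  exists p : 'I_lambda * bool -> 'I_(2 * lambda), bijective p.
Proof.
have E : #|{: 'I_lambda * bool}| = (2 * lambda)%N.
  by rewrite card_prod card_ord card_bool mulnC.
exists (fun z => cast_ord E (enum_rank z)).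
exists (fun r => enum_val (cast_ord (esym E) r)) => z.
  by rewrite cast_ordK enum_rankK.
by rewrite enum_valK cast_ordKV.
Qed.

(** The first transposition sends [x] to [r]; the second moves the image of [y] to [r'] and fixes
    [r], which differs from both. *)
Lemma perm_two_points (T : finType) (x y r r' : T) :
  x != y -> r != r' -> exists s : {perm T}, s x = r /\ s y = r'.
Proof.
move=> xy rr; exists (tperm x r * tperm (tperm x r y) r')%g.
rewrite !permM; split; last by rewrite tpermL.
rewrite (tpermL x r) tpermD //; last by rewrite eq_sym.
by rewrite -{2}(tpermL x r) (inj_eq perm_inj) eq_sym.
Qed.

Lemma block_bijection_through (lambda : nat) (i : 'I_lambda)
    (r r' : 'I_(2 * lambda)) :
  r != r' -> exists p : 'I_lambda * bool -> 'I_(2 * lambda),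
    [/\ bijective p, p (i, false) = r & p (i, true) = r'].
Proof.
move=> rr; have [p bp] := block_bijection lambda.
have neq : p (i, false) != p (i, true).
  by rewrite (inj_eq (bij_inj bp)) xpair_eqE andbF.
have [s [sr sr']] := perm_two_points neq rr.
by exists (s \o p); split=> //; apply: bij_comp bp; exact: injF_bij perm_inj.
Qed.

(** * A mate for rectangle-even squares when [lambda] is even *)

Lemma alternating_sign_sum (mu : nat) :
  \sum_(i < 2 * mu) (-1) ^+ (odd i) = 0 :> int.
Proof.
elim: mu => [|mu IH]; first by rewrite muln0 big_ord0.
rewrite mulnS !addSn add0n !big_ord_recr /= IH.
by rewrite oddM /=.
Qed.

(** For balanced [f], the two equations together say that [h] halves each class of [f]. Each class
    has [lambda] elements; number them and let [h] be the parity of the number. *)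
Lemma halving_vector (lambda : nat) (f : 'I_(2 * lambda) -> bool) :
  ~~ odd lambda -> \sum_i (-1) ^+ (f i) = 0 :> int ->
  exists h : 'I_(2 * lambda) -> bool,
    \sum_i (-1) ^+ (h i) = 0 :> int /\
    \sum_i (-1) ^+ (f i (+) h i) = 0 :> int.
Proof.
move=> evl sf; have [p bp] := block_bijection lambda; have [p' pK p'K] := bp.
have sp : \sum_i (-1) ^+ (p' i).2 = 0 :> int.
  rewrite (reindex p) /=; last exact: onW_bij.
  under eq_bigr do rewrite pK.
  rewrite sum_pair /= big1 // => i _.
  by rewrite big_bool.
have [s Hs] := sign_sum_perm (etrans sf (esym sp)).
(* The map [s \o p] sends [(j, x)] to the element numbered [j] of the class [f = x]. *)
exists (fun i => odd (p' (s^-1 i)%g).1).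
have bsp : bijective (s \o p) by apply: bij_comp bp; exact: injF_bij perm_inj.
split; rewrite (reindex (s \o p)) /=; try exact: onW_bij.
  under eq_bigr do rewrite permK pK.
  rewrite sum_pair /=.
  under eq_bigr do rewrite big_bool.
  rewrite big_split /=.
  have -> : lambda = (2 * lambda./2)%N by lia.
  by rewrite alternating_sign_sum.
under eq_bigr do rewrite permK -Hs pK.
rewrite sum_pair /=.
by rewrite big1 // => i _; rewrite big_bool; case: (odd i).
Qed.

Lemma rect_even_even_mate (lambda : nat) (F : 'M[bool]_(2 * lambda)) :
  (0 < lambda)%N -> ~~ odd lambda -> rect_even F -> frequency_square F ->
  exists G, frequency_square G /\ orthogonal_squares F G.
Proof.
move=> lam0 evl evF fsF.
have [|f [g [FE sf sg]]] := rect_even_split _ fsF evF; first by lia.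
have [h [sh sfh]] := halving_vector evl sf.
have [k [sk sgk]] := halving_vector evl sg.
exists (\matrix_(r, c) (h r (+) k c)).
have fsG : frequency_square (\matrix_(r, c) (h r (+) k c)).
  apply/frequency_squareP; split=> [|r|c]; first by rewrite oddM.
    by under eq_bigr do rewrite mxE signr_addb; rewrite -mulr_sumr sk mulr0.
  by under eq_bigr do rewrite mxE signr_addb; rewrite -mulr_suml sh mul0r.
split=> //; apply/(orthogonal_squaresP fsF fsG).
rewrite big1 // => r _.
under eq_bigr do rewrite FE mxE addbACA signr_addb.
by rewrite -mulr_sumr sgk mulr0.
Qed.

(** * Choosing signs to cancel a sum *)

Lemma greedy_signs (I : eqType) (s : seq I) (d : I -> int) :
  uniq s -> (forall i, `|d i| <= 2) ->
  exists e : I -> bool, `|\sum_(i <- s) (-1) ^+ (e i) * d i| <= 2.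
Proof.
move=> us d2; elim: s us => [|j s IH] /=.
  by exists (fun=> false); rewrite big_nil.
case/andP=> js /IH[e He].
pose S : int := \sum_(i <- s) (-1) ^+ (e i) * d i.
(* The new term gets the sign opposite to the partial sum [S], so the absolute values subtract and
   stay within 2. *)
exists (fun i => if i == j then (0 <= d j) == (0 <= S) else e i).
rewrite big_cons eqxx (_ : \sum_(i <- s) _ = S); last first.
  apply: eq_big_seq => i si; case: eqP => // ij.
  by rewrite ij in si; rewrite si in js.
move: He (d2 j); rewrite -/S; move: S (d j) => S x.
by case: (lerP 0 x); case: (lerP 0 S); rewrite /= ?expr0 ?expr1 => *; lia.
Qed.

Lemma balancing_signs (I : finType) (d : I -> int) (q : I) :
  (forall i, `|d i| <= 2) -> `|d q| = 1 ->
  (exists m : int, \sum_i d i = 2 * m) ->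
  exists e : I -> bool, \sum_i (-1) ^+ (e i) * d i = 0.
Proof.
move=> d2 dq [m Hm].
have ue : uniq (rem q (index_enum I)) by apply: rem_uniq; exact: index_enum_uniq.
have [e He] := greedy_signs ue d2.
pose S : int := \sum_(i | i != q) (-1) ^+ (e i) * d i.
have SE : \sum_(i <- rem q (index_enum I)) (-1) ^+ (e i) * d i = S.
  rewrite (rem_filter _ (index_enum_uniq I)) big_filter /S.
  by apply: eq_bigl.
(* Sign changes preserve parity, so [S] is odd like the unsigned sum without [q]; the greedy bound
   then leaves only 1 and -1. *)
have [k Hk] : exists k : int, S = \sum_(i | i != q) d i + 2 * k.
  exists (\sum_(i | i != q) - (e i : nat)%:Z * d i).
  rewrite mulr_sumr -big_split; apply: eq_bigr => i _ /=.
  by case: (e i) => /=; ring.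
(* [d q] is negated exactly when it has the same sign as [S]. *)
exists (fun i => if i == q then 0 < d q * S else e i).
rewrite (bigD1 q) //= eqxx (eq_bigr (fun i => (-1) ^+ (e i) * d i)); last first.
  by move=> i /negbTE ->.
rewrite -/S; move: Hm; rewrite (bigD1 q) //= => Hm.
rewrite SE in He; move: S (\sum_(i | i != q) d i) Hk Hm He {SE} => S D Hk Hm He.
have [dqE|dqE] : d q = 1 \/ d q = -1 by lia.
  by rewrite dqE in Hm *; case: ltrP; rewrite /= ?expr0 ?expr1 => *; lia.
by rewrite dqE in Hm *; case: ltrP; rewrite /= ?expr0 ?expr1 => *; lia.
Qed.

(** * A mate from an odd rectangle *)

Lemma rect_odd_mate (lambda : nat) (F : 'M[bool]_(2 * lambda))
    (r r' c c' : 'I_(2 * lambda)) :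
  frequency_square F -> F r c (+) F r c' != F r' c (+) F r' c' ->
  exists G, frequency_square G /\ orthogonal_squares F G.
Proof.
move=> fsF Fodd.
have rr : r != r' by apply: contraNneq Fodd => ->.
have cc : c != c' by apply: contraNneq Fodd => ->; rewrite !addbb.
have lam0 : (0 < lambda)%N by have := ltn_ord r; lia.
pose i0 := Ordinal lam0.
have [p [bp p0 p1]] := block_bijection_through i0 rr.
have [q [bq q0 q1]] := block_bijection_through i0 cc.
have [p' pK p'K] := bp; have [q' qK q'K] := bq.
pose F' i x j y : int := (F (p (i, x)) (q (j, y)) : nat)%:Z.
pose d (ij : 'I_lambda * 'I_lambda) := \sum_x \sum_y
  (-1) ^+ (x (+) y) * F' ij.1 x ij.2 y.
have reind (H : 'I_(2 * lambda) -> 'I_(2 * lambda) -> int) :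
    \sum_r \sum_c H r c = \sum_i \sum_j \sum_x \sum_y H (p (i, x)) (q (j, y)).
  rewrite (reindex p) /=; last exact: onW_bij.
  rewrite sum_pair /=.
  apply: eq_bigr => i _; rewrite [RHS]exchange_big; apply: eq_bigr => x _.
  rewrite (reindex q) /=; last exact: onW_bij.
  by rewrite sum_pair.
have d2 ij : `|d ij| <= 2.
  rewrite /d !big_bool /= /F'; set P := (p _); set P' := (p _).
  by do 4 case: (F _ _).
(* Block [(i0, i0)] is the odd rectangle, so its alternating sum is odd and lies in [-2, 2]. *)
have dq : `|d (i0, i0)| = 1.
  rewrite /d !big_bool /= /F' p0 p1 q0 q1; move: Fodd.
  by do 4 case: (F _ _).
have Fbal : \sum_r \sum_c (F r c : nat)%:Z = 2 * (lambda%:Z * lambda%:Z).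
  have := frequency_square_sum fsF; rewrite !pair_bigA /= => s0.
  set S := LHS; suff: S * 2 = (2 * lambda * (2 * lambda))%N by lia.
  transitivity (#|{: 'I_(2 * lambda) * 'I_(2 * lambda)}|%:Z
                - \sum_rc (-1) ^+ F rc.1 rc.2); last first.
    by rewrite s0 card_prod card_ord subr0.
  rewrite -sum_one_int -sumrB mulr_suml.
  by apply: eq_bigr => rc _; case: (F rc.1 rc.2).
(* Since [(-1)^(x (+) y) = 1 - 2 (x (+) y)], the total of [d] has the parity of the number of ones
   of [F], namely [2 lambda^2]. *)
have deven : exists m : int, \sum_ij d ij = 2 * m.
  exists (lambda%:Z * lambda%:Z
    - \sum_i \sum_j \sum_x \sum_y ((x (+) y : nat)%:Z * F' i x j y)).
  rewrite mulrBr -Fbal reind mulr_sumr -sumrB [LHS]sum_pair /=.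
  apply: eq_bigr => i _; rewrite mulr_sumr -sumrB; apply: eq_bigr => j _.
  by rewrite /d !big_bool /= /F'; ring.
have [e He] := balancing_signs d2 dq deven.
(* Each block carries the pattern [x (+) y], flipped according to [e]; every row and column of a
   block then holds one 0 and one 1. *)
pose G : 'M[bool]_(2 * lambda) :=
  \matrix_(r, c) (e ((p' r).1, (q' c).1) (+) ((p' r).2 (+) (q' c).2)).
have fsG : frequency_square G.
  apply/frequency_squareP; split=> [|a|b]; first by rewrite oddM.
    rewrite (reindex q) /=; last exact: onW_bij.
    under eq_bigr do rewrite mxE qK.
    rewrite sum_pair /=.
    by rewrite big1 // => j _; rewrite big_bool; case: (e _); case: ((p' a).2).
  rewrite (reindex p) /=; last exact: onW_bij.
  under eq_bigr do rewrite mxE pK.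
  rewrite sum_pair /=.
  by rewrite big1 // => j _; rewrite big_bool; case: (e _); case: ((q' b).2).
exists G; split=> //; apply/(orthogonal_squaresP fsF fsG).
(* By [(-1)^F = 1 - 2 F], and since [G] is balanced, only the sum of [(-1)^G F] matters; blockwise
   it is the signed sum of [d]. *)
transitivity (\sum_r \sum_c (-1) ^+ G r c
              - 2 * \sum_r \sum_c (-1) ^+ G r c * (F r c : nat)%:Z : int).
  rewrite mulr_sumr -sumrB; apply: eq_bigr => a _.
  rewrite mulr_sumr -sumrB; apply: eq_bigr => b _.
  by case: (F a b); case: (G a b).
rewrite (frequency_square_sum fsG) reind.
suff -> : \sum_i \sum_j \sum_x \sum_y (-1) ^+ G (p (i, x)) (q (j, y)) *
    (F (p (i, x)) (q (j, y)) : nat)%:Z = 0 :> int by [].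
rewrite -[RHS]He [RHS]sum_pair /=.
apply: eq_bigr => i _; apply: eq_bigr => j _; rewrite /d mulr_sumr.
apply: eq_bigr => x _; rewrite mulr_sumr; apply: eq_bigr => y _.
by rewrite mxE pK qK /= [in LHS]signr_addb mulrA.
Qed.

Local Close Scope ring_scope.

(** * Characterisation of the bachelors *)

Theorem theorem3p2 (lambda : nat) (B : 'M[bool]_(2 * lambda)) :
  0 < lambda -> frequency_square B ->
  (bachelor B <-> odd lambda /\ isomorphic B (A_square lambda)).
Proof.
move=> lam0 fsB; split=> [[_ nomate]|[odl iso]].
  have evB : rect_even B.
    move=> r r' c c'; apply/eqP; apply: contraT => odd_rect.
    by case: nomate; exact: rect_odd_mate odd_rect.
  split; last exact: rect_even_isomorphic_A.
  by apply: contraT => evl; case: nomate; exact: rect_even_even_mate.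
split=> // -[G [fsG]]; apply: rect_even_odd_no_mate => //.
exact: isomorphic_rect_even iso (@rect_even_A_square lambda).
Qed.
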